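(* Let $n\geq2$, let $H=\{x\in\mathbb{R}^{n+1}:\sum_{i=1}^{n+1}x_i=0\}$ (an $n$-dimensional space identified with $\mathbb{R}^n$), let $A_n=\mathbb{Z}^{n+1}\cap H$, and let $\mathcal{P}\subset H$ be the Voronoi region of the lattice $A_n$ in $H$. Then $m_1(\mathbb{R}^n,\Vert\cdot\Vert_{\mathcal{P}})=\frac{1}{2^n}$.
   Context: The Voronoi region of a lattice $\Lambda$ in a Euclidean space $E$ is $\{z\in E:\langle z-x,z-x\rangle\geq\langle z,z\rangle\ \forall x\in\Lambda\}$; it is a convex polytope symmetric about $0$. For such a polytope $\mathcal{P}$, $\Vert x\Vert_{\mathcal{P}}=\inf\{\lambda\geq0:x\in\lambda\mathcal{P}\}$. A set $A$ avoids distance $1$ if $\Vert x-y\Vert\neq1$ for all $x,y\in A$. The density of a measurable $A\subset\mathbb{R}^n$ is $\delta(A)=\limsup_{R\to\infty}\operatorname{Vol}(A\cap[-R,R]^n)/\operatorname{Vol}([-R,R]^n)$, and $m_1(\mathbb{R}^n,\Vert\cdot\Vert)$ is the supremum of $\delta(A)$ over measurable $A$ avoiding distance $1$. *)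

(* Defs.v *)
From HB Require Import structures.
From mathcomp Require Import all_boot all_order all_algebra.
From mathcomp Require Import all_classical all_reals all_analysis.

Set Implicit Arguments.
Unset Strict Implicit.
Unset Printing Implicit Defensive.

Import Order.TTheory GRing.Theory Num.Theory.
Local Open Scope classical_set_scope.
Local Open Scope ring_scope.

Section Defs.
Variable R : realType.

Definition inner (m : nat) (x y : 'I_m -> R) : R := \sum_(i < m) x i * y i.

Definition voronoi (m : nat) (E L : set ('I_m -> R)) : set ('I_m -> R) :=
  [set z | E z /\ forall x, L x ->
     inner z z <= inner (fun i => z i - x i) (fun i => z i - x i)].

Definition pnorm (m : nat) (P : set ('I_m -> R)) (y : 'I_m -> R) : R :=
  inf [set l : R | 0 <= l /\ exists p, P p /\ forall i, y i = l * p i].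

Definition hyperH (n : nat) : set ('I_n.+1 -> R) :=
  [set x | \sum_(i < n.+1) x i = 0].

Definition latticeA (n : nat) : set ('I_n.+1 -> R) :=
  [set x | (forall i, x i \is a Num.int) /\ @hyperH n x].

Definition voronoiA (n : nat) : set ('I_n.+1 -> R) :=
  voronoi (@hyperH n) (@latticeA n).

(* linear isomorphism R^n -> H, x |-> (x_1, ..., x_n, - sum_i x_i) *)
Definition embedH (n : nat) (x : 'I_n -> R) : 'I_n.+1 -> R :=
  fun i => if unlift ord_max i is Some j then x j else - \sum_(j < n) x j.

Definition normA (n : nat) (x : 'I_n -> R) : R := pnorm (@voronoiA n) (embedH x).

Definition box (m : nat) (a b : 'I_m -> R) : set ('I_m -> R) :=
  [set x | forall i, a i <= x i <= b i].

Definition leb_outer (m : nat) (A : set ('I_m -> R)) : \bar R :=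
  ereal_inf [set s | exists a b : nat -> 'I_m -> R,
     (forall k i, a k i <= b k i) /\
     A `<=` \bigcup_k box (a k) (b k) /\
     s = (\sum_(0 <= k <oo) (\prod_(i < m) (b k i - a k i))%:E)%E].

Definition leb_measurable (m : nat) (A : set ('I_m -> R)) : Prop :=
  forall E : set ('I_m -> R),
    leb_outer E = (leb_outer (E `&` A) + leb_outer (E `\` A))%E.

Definition cube (m : nat) (r : R) : set ('I_m -> R) := box (fun=> - r) (fun=> r).

(* density: limsup_{r -> oo} Vol(A ∩ [-r,r]^m) / Vol([-r,r]^m) *)
Definition density (m : nat) (A : set ('I_m -> R)) : \bar R :=
  ereal_inf [set ereal_sup [set (leb_outer (A `&` @cube m r)
                                  * ((2 * r) ^+ m)^-1%:E)%E | r in [set r | M < r]]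
            | M in [set M : R | 0 < M]].

Definition avoids_one (m : nat) (N : ('I_m -> R) -> R) (A : set ('I_m -> R)) :=
  forall x y, A x -> A y -> N (fun i => x i - y i) <> 1.

Definition m1 (m : nat) (N : ('I_m -> R) -> R) : \bar R :=
  ereal_sup [set density A | A in [set A | leb_measurable A /\ avoids_one N A]].

End Defs.

(* Main.v *)
Require Import Defs.
From HB Require Import structures.
From mathcomp Require Import all_boot all_order all_algebra.
From mathcomp Require Import all_classical all_reals all_analysis.
From mathcomp Require Import measurable_realfun zify ring lra.
Import Order.TTheory GRing.Theory Num.Theory.
Import numFieldNormedType.Exports.
Local Open Scope classical_set_scope.
Local Open Scope ring_scope.

Set Implicit Arguments.
Unset Strict Implicit.
Unset Printing Implicit Defensive.

(** The norm attached to the Voronoi region of [A_n] is [max_i z_i - min_i z_i]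
    on the hyperplane [H].

    Upper bound: let [A] avoid distance 1 and, for [T] a set of coordinates, let
    [v_T] be half the projection to [H] of the indicator of [T].  If [U] and [V]
    are incomparable, then [v_U - v_V] has norm 1; hence for [x] in [A] the
    nonempty [T] with [x + v_T] in [A] form a chain and have a common element
    [b(x)].  The points [x + v_U], for [x] in [A] and [U] not containing [b(x)],
    are then pairwise distinct: [x + v_U = y + v_V] with [V] strictly contained
    in [U] gives [y = x + v_(U \ V)] in [A] although [U \ V] misses [b(x)].  So
    there are [2^n] disjoint translates of (pieces of) [A].

    Lower bound: breaking ties by the order of the coordinates gives a half-open
    Voronoi cell [C].  The set [C/2 + A_n] avoids distance 1, and its [2^n]
    translates by [A_n/2] cover [H] because [C + A_n = H]. *)

(** * Lebesgue outer measure and its Caratheodory measurable sets *)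

Section LebesgueOuter.
Variables (R : realType) (m : nat).
Implicit Types (A : set ('I_m.+1 -> R)) (a b : 'I_m.+1 -> R).

Lemma box_volume_ge0 k (a b : 'I_k -> R) :
  (forall i, a i <= b i) -> 0 <= \prod_i (b i - a i).
Proof. by move=> ab; apply: prodr_ge0 => i _; rewrite subr_ge0. Qed.

Lemma leb_outer_ge0 k (A : set ('I_k -> R)) : (0 <= leb_outer A)%E.
Proof.
apply: le_ereal_inf_tmp => _ [a [b [ab [_ ->]]]].
by apply: nneseries_ge0 => j _ _; rewrite lee_fin box_volume_ge0.
Qed.

Lemma le_leb_outer k (A B : set ('I_k -> R)) :
  A `<=` B -> (leb_outer A <= leb_outer B)%E.
Proof.
move=> AB; apply: ereal_inf_le_tmp => _ [a [b [ab [Bab ->]]]].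
by exists a, b; split => //; split => //; exact: subset_trans Bab.
Qed.

Lemma leb_outer_box a b : (forall i, a i <= b i) ->
  (leb_outer (box a b) <= (\prod_i (b i - a i))%:E)%E.
Proof.
move=> ab; apply: ereal_inf_lbound.
(* The cover is padded with one-point boxes, whose volume vanishes because the dimension is
   positive. *)
exists (fun k => if k is 0%N then a else fun=> 0),
  (fun k => if k is 0%N then b else fun=> 0); split; first by case.
split; first by move=> x abx; exists 0%N.
rewrite nneseries_recl//; last by case=> [|k]; rewrite lee_fin box_volume_ge0.
rewrite eseries_cond/= eseries0 ?adde0// => -[|k]//= _ _.
by rewrite big_ord_recl subrr mul0r.
Qed.

Lemma leb_outer0 : leb_outer (set0 : set ('I_m.+1 -> R)) = 0%E.
Proof.
apply/eqP; rewrite eq_le leb_outer_ge0 andbT.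
apply: le_trans (le_leb_outer (sub0set (box (fun=> 0) (fun=> 0)))) _.
by apply: le_trans (leb_outer_box _) _ => //; rewrite big_ord_recl subrr mul0r.
Qed.

(** Near-optimal covers of the [A n], with errors [e / 2 ^ n.+1], are merged into one cover along a
    bijection between [nat] and [nat * nat]. *)
Lemma leb_outer_sigma_subadditive :
  sigma_subadditive (@leb_outer R m.+1).
Proof.
move=> A; have [[i ioo]|] := pselect (exists i, leb_outer (A i) = +oo%E).
  rewrite (eseries_pinfty _ _ ioo) ?leey// => n _.
  by rewrite -ltNye (lt_le_trans _ (leb_outer_ge0 _)).
rewrite -forallNE => Aoo; apply/lee_addgt0Pr => e e0.
apply: le_trans (epsilon_trick xpredT _ (ltW e0)); last first.
  by move=> n; exact: leb_outer_ge0.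
pose P n (ab : nat -> (('I_m.+1 -> R) * ('I_m.+1 -> R))) :=
  [/\ forall k i, (ab k).1 i <= (ab k).2 i,
      A n `<=` \bigcup_k box (ab k).1 (ab k).2 &
      (\sum_(0 <= k <oo) (\prod_i ((ab k).2 i - (ab k).1 i))%:E
       <= leb_outer (A n) + (e / (2 ^ n.+1)%:R)%:E)%E].
have [G PG] : {G & forall n, P n (G n)}.
  apply: (@choice _ _ P) => n.
  have en : 0 < e / (2 ^ n.+1)%:R by rewrite divr_gt0// ltr0n expn_gt0.
  have fA : leb_outer (A n) \is a fin_num.
    by rewrite ge0_fin_numE ?leb_outer_ge0// ltey; apply/eqP; exact: Aoo.
  have [_ [a [b [ab [Aab ->]]]] le] := lb_ereal_inf_adherent en fA.
  by exists (fun k => (a k, b k)); split => //; exact: ltW.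
pose v (p : nat * nat) : \bar R :=
  (\prod_i ((G p.1 p.2).2 i - (G p.1 p.2).1 i))%:E.
have v0 p : (0 <= v p)%E by rewrite lee_fin box_volume_ge0//; case: (PG p.1).
apply: (@le_trans _ _ (\esum_(p in setT) v p)).
  have /card_esym/ppcard_eqP[f] := card_nat2.
  apply: ereal_inf_lbound.
  exists (fun k => (G (f k).1 (f k).2).1), (fun k => (G (f k).1 (f k).2).2).
  split; first by move=> k; case: (PG (f k).1).
  split.
    move=> x [n _]; have [_ Aab _] := PG n => /Aab[k _ xk].
    by exists (f^-1%FUN (n, k)) => //=; rewrite invK ?inE.
  rewrite (reindex_esum [set: nat] _ f)//.
  by rewrite -nneseries_esumT.
have -> : [set: nat * nat] = setT `*`` (fun=> setT) by apply/seteqP; split.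
rewrite -(esum_esum (a := fun i j => v (i, j)))//.
rewrite -nneseries_esumT; last by move=> n; apply: esum_ge0 => k _; exact: v0.
apply: lee_nneseries => [n _ _|n _]; first by apply: esum_ge0 => k _; exact: v0.
rewrite -nneseries_esumT//; by case: (PG n).
Qed.

HB.instance Definition _ := isOuterMeasure.Build R ('I_m.+1 -> R)
  (@leb_outer R m.+1) leb_outer0 (@leb_outer_ge0 m.+1)
  (@le_leb_outer m.+1) leb_outer_sigma_subadditive.

Local Notation lspace := (caratheodory_type (@leb_outer R m.+1)).

Lemma measurable_leb (A : set lspace) : measurable A <-> leb_measurable A.
Proof. by []. Qed.

(** The hyperplane cuts each box of a cover into two boxes whose volumes add up, so a cover of [E]
    yields covers of its two parts at the same total cost. *)
Lemma measurable_coordinate_le (i0 : 'I_m.+1) (c : R) :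
  measurable ([set x | x i0 <= c] : set lspace).
Proof.
apply: le_caratheodory_measurable => E; apply: le_ereal_inf_tmp.
move=> _ [a [b [ab [Eab ->]]]].
(* [d k] is [c] clamped to the side of the box, so that both pieces are boxes, possibly flat, even
   when the hyperplane misses the box. *)
pose d k := Num.max (a k i0) (Num.min (b k i0) c).
pose a' k i := if i == i0 then d k else a k i.
pose b' k i := if i == i0 then d k else b k i.
have ad k : a k i0 <= d k by rewrite le_max lexx.
have db k : d k <= b k i0 by rewrite ge_max ab ge_min lexx.
have ab' k i : a k i <= b' k i by rewrite /b'; case: eqP => [->|].
have a'b k i : a' k i <= b k i by rewrite /a'; case: eqP => [->|].
have volD k : \prod_i (b k i - a k i) =
    \prod_i (b' k i - a k i) + \prod_i (b k i - a' k i).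
  rewrite (bigD1 i0)//= [X in _ = X + _](bigD1 i0)//=.
  rewrite [X in _ = _ + X](bigD1 i0)//= /a' /b' eqxx.
  rewrite [X in _ = _ * X + _](eq_bigr (fun i => b k i - a k i)); last first.
    by move=> i /negbTE ->.
  rewrite [X in _ = _ + _ * X](eq_bigr (fun i => b k i - a k i)); last first.
    by move=> i /negbTE ->.
  by rewrite -mulrDl; congr (_ * _); ring.
under eq_eseriesr do rewrite volD EFinD.
rewrite nneseriesD; last 2 first.
- by move=> k _ _; rewrite lee_fin box_volume_ge0.
- by move=> k _ _; rewrite lee_fin box_volume_ge0.
apply: leeD; apply: ereal_inf_lbound.
- exists a, b'; split => //; split => // x [Ex xc].
  have [k _ abx] := Eab x Ex; exists k => // i.
  have /andP[ax xb] := abx i; rewrite ax/= /b'; case: eqP => // ->.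
  by rewrite le_max le_min (andP (abx i0)).2 xc orbT.
- exists a', b; split => //; split => // x [Ex /= xc].
  have [k _ abx] := Eab x Ex; exists k => // i.
  have /andP[ax xb] := abx i; rewrite xb andbT /a'; case: eqP => // ->.
  rewrite ge_max (andP (abx i0)).1 ge_min.
  by rewrite (ltW (_ : c < x i0)) ?orbT// ltNge; apply/negP.
Qed.

Lemma measurable_coordinate (i : 'I_m.+1) :
  measurable_fun [set: lspace] (fun x : lspace => x i).
Proof.
apply: (measurability _ (RGenOInfty.measurableE R)) => _ [_ [c ->]] <-.
rewrite setTI (_ : _ @^-1` _ = ~` [set x : lspace | x i <= c]).
  exact/measurableC/measurable_coordinate_le.
by apply/seteqP; split => x /=; rewrite in_itv/= andbT ltNge => /negP.
Qed.

End LebesgueOuter.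

(** Membership is tested at [x + t], so this is [A] moved by [- t]. *)
Definition translate (R : realType) m (t : 'I_m -> R) (A : set ('I_m -> R)) :
  set ('I_m -> R) := [set x | A (fun i => x i + t i)].

(** * Translation invariance of outer measure and measurability *)

Section Translation.
Variable R : realType.

Lemma translateK m (t : 'I_m -> R) A : translate (fun i => - t i) (translate t A) = A.
Proof.
by rewrite /translate/=; apply/seteqP; split => x /=;
  under eq_fun do rewrite subrK.
Qed.

Lemma leb_outer_translate m (t : 'I_m -> R) A : leb_outer (translate t A) = leb_outer A.
Proof.
(* One inequality for every shift suffices, since the opposite shift undoes it. *)
have le s B : (leb_outer (translate s B) <= leb_outer B)%E.
  apply: le_ereal_inf_tmp => _ [a [b [ab [Bab ->]]]].
  apply: ereal_inf_lbound.
  exists (fun k i => a k i - s i), (fun k i => b k i - s i).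
  split; first by move=> k i; rewrite lerB.
  split.
    move=> x /Bab[k _ xk]; exists k => // i.
    by have := xk i; rewrite lerBlDr lerBrDr.
  apply: eq_eseriesr => k _; congr EFin; apply: eq_bigr => i _.
  by rewrite opprB addrA subrK.
apply/eqP; rewrite eq_le le/= -[X in (leb_outer X <= _)%E](translateK t).
exact: le.
Qed.

Lemma leb_measurable_translate m (t : 'I_m -> R) A :
  leb_measurable A -> leb_measurable (translate t A).
Proof.
move=> mA E.
rewrite -(leb_outer_translate (fun i => - t i) E) (mA (translate (fun i => - t i) E)).
rewrite -(leb_outer_translate t (translate (fun i => - t i) E `&` A)).
rewrite -(leb_outer_translate t (translate (fun i => - t i) E `\` A)).
have translateNK : translate t (translate (fun i => - t i) E) = E.
  by rewrite -[RHS](translateK (fun i => - t i)); under [in RHS]eq_fun do rewrite opprK.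
by rewrite -[in RHS]translateNK.
Qed.

End Translation.

(** * Lower bound for the outer measure of a box *)

Section BoxVolume.
Variable R : realType.
Local Notation mu := (@lebesgue_measure R).

(* Induction on the dimension: slicing along the first coordinate and integrating
   over it avoids any compactness argument.  The predicate [P] discards the boxes
   that miss the slice, which in dimension 0 cannot be replaced by null boxes. *)
Lemma box_volume_le_cover m (a b : 'I_m -> R) (c d : nat -> 'I_m -> R)
    (P : pred nat) :
  (forall i, a i <= b i) -> (forall k i, c k i <= d k i) ->
  box a b `<=` \bigcup_(k in [set k | P k]) box (c k) (d k) ->
  ((\prod_i (b i - a i))%:E <=
   \sum_(0 <= k <oo) ((P k)%:R * \prod_i (d k i - c k i))%:E)%E.
Proof.
elim: m => [|m IH] in a b c d P *.
  move=> _ _ /(_ a)[[]//|k /= Pk _].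
  rewrite big_ord0; apply: le_trans (nneseries_lim_ge k.+1 _); last first.
    by move=> j _; rewrite big_ord0 lee_fin mulr1.
  rewrite big_nat_recr//= big_ord0 Pk mulr1 leeDr//.
  by apply: sume_ge0 => j _; rewrite big_ord0 lee_fin mulr1.
move=> ab cd abcd.
pose tl (u : 'I_m.+1 -> R) := fun i : 'I_m => u (lift ord0 i).
pose V (u v : 'I_m.+1 -> R) := \prod_i (tl v i - tl u i).
pose I (u v : 'I_m.+1 -> R) : set R := `[u ord0, v ord0]%classic.
have V0 u v : (forall i, u i <= v i) -> 0 <= V u v.
  by move=> uv; apply: box_volume_ge0 => i; exact: uv.
have pV0 k : 0 <= (P k)%:R * V (c k) (d k) by rewrite mulr_ge0// V0.
(* At a fixed first coordinate [t] this is the induction hypothesis for the boxes whose first side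
   contains [t]; integrating over [t] then gives the claim. *)
have slice t : ((V a b)%:E * (\1_(I a b) t)%:E <=
    \sum_(0 <= k <oo)
      ((P k)%:R * V (c k) (d k))%:E * (\1_(I (c k) (d k)) t)%:E)%E.
  rewrite indicE; have [/set_mem tI|_] := boolP (t \in I a b); last first.
    by rewrite mule0; apply: nneseries_ge0 => k _ _; rewrite -EFinM lee_fin mulr_ge0.
  rewrite mule1.
  apply: le_trans (IH _ _ (fun k => tl (c k)) (fun k => tl (d k))
     (fun k => P k && (t \in I (c k) (d k))) _ _ _) _.
  - by move=> i; exact: ab.
  - by move=> k i; exact: cd.
  - move=> x' x'ab; pose x i := if unlift ord0 i is Some j then x' j else t.
    have [i|k /= Pk xk] := abcd x.
      rewrite /x; case: unliftP => [j ->|->]; first exact: x'ab.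
      by move: tI; rewrite /I/= in_itv.
    exists k => /=.
      rewrite Pk/=; apply/mem_set; rewrite /I/= in_itv/=.
      by have := xk ord0; rewrite /x unlift_none.
    by move=> i; have := xk (lift ord0 i); rewrite /x liftK.
  by rewrite le_eqVlt; apply/orP; left; apply/eqP; apply: eq_eseriesr => k _;
    rewrite indicE -EFinM -mulnb natrM mulrAC.
have mIuv u v : measurable (I u v) by exact: measurable_itv.
have int (r : R) u v : 0 <= r -> (forall i, u i <= v i) ->
  (\int[mu]_x ((r * V u v)%:E * (\1_(I u v) x)%:E) =
    (r * \prod_i (v i - u i))%:E)%E.
  move=> r0 uv; rewrite ge0_integralZl//; last 2 first.
  - by apply/measurable_EFinP; apply: measurable_indic; exact: mIuv.
  - by rewrite lee_fin mulr_ge0// V0.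
  rewrite integral_indic//; last exact: mIuv.
  rewrite setIT [X in (_ * X)%E]lebesgue_measure_itv/= lte_fin.
  rewrite big_ord_recl; have [uv0|vu] := ltP (u ord0) (v ord0).
    by rewrite -EFinB -EFinM -mulrA (mulrC (V u v)).
  rewrite (le_anti (_ : u ord0 <= v ord0 <= u ord0)) ?uv//.
  by rewrite subrr mul0r mulr0 mule0.
have mI (r : R) u v :
    measurable_fun setT (fun x : R => r%:E * (\1_(I u v) x)%:E)%E.
  apply: measurable_funeM; apply/measurable_EFinP.
  by apply: measurable_indic; exact: mIuv.
rewrite -[X in (X%:E <= _)%E]mul1r -int//.
under eq_eseriesr do rewrite -int//.
rewrite -integral_nneseries//; last 2 first.
- by move=> k; exact: mI.
- by move=> k x _; rewrite -EFinM lee_fin mulr_ge0.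
apply: ge0_le_integral => //.
- by move=> x _; rewrite -EFinM lee_fin mulr_ge0// mul1r V0.
- exact: mI.
- apply: ge0_emeasurable_sum => [k x _ _|k _]; last exact: mI.
  by rewrite -EFinM lee_fin mulr_ge0.
- by move=> x _; rewrite mul1r; exact: slice.
Qed.

Lemma leb_outer_box_ge m (a b : 'I_m -> R) : (forall i, a i <= b i) ->
  ((\prod_i (b i - a i))%:E <= leb_outer (box a b))%E.
Proof.
move=> ab; apply: le_ereal_inf_tmp => _ [c [d [cd [abcd ->]]]].
have := @box_volume_le_cover m a b c d xpredT ab cd.
rewrite set_true; under eq_eseriesr do rewrite mul1r.
exact.
Qed.

End BoxVolume.

(** * The Voronoi region of [A_n] and its norm *)

Section Norm.
Variables (R : realType) (n : nat).
Implicit Types (x y : 'I_n -> R) (z : 'I_n.+1 -> R).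

Lemma embedH_lift x j : embedH x (lift ord_max j) = x j.
Proof. by rewrite /embedH liftK. Qed.

Lemma embedH_max x : embedH x ord_max = - \sum_j x j.
Proof. by rewrite /embedH unlift_none. Qed.

Lemma embedH_hyperH x : hyperH (embedH x).
Proof.
rewrite /hyperH/= (bigD1_ord ord_max)//= embedH_max.
by under eq_bigr do rewrite embedH_lift; rewrite addNr.
Qed.

Lemma eq_embedH x z : hyperH z -> (forall j, x j = z (lift ord_max j)) ->
  embedH x = z.
Proof.
move=> zH xz; apply/funext => i; case: (unliftP ord_max i) => [j ->|->].
  by rewrite embedH_lift xz.
rewrite embedH_max; move: zH; rewrite /hyperH/= (bigD1_ord ord_max)//=.
move=> /eqP; rewrite addr_eq0 => /eqP ->; congr (- _).
by apply: eq_bigr => j _; rewrite xz.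
Qed.

Lemma embedHD x y i : embedH (fun j => x j + y j) i = embedH x i + embedH y i.
Proof.
case: (unliftP ord_max i) => [j ->|->]; first by rewrite !embedH_lift.
by rewrite !embedH_max big_split opprD.
Qed.

Lemma embedHN x i : embedH (fun j => - x j) i = - embedH x i.
Proof.
case: (unliftP ord_max i) => [j ->|->]; first by rewrite !embedH_lift.
by rewrite !embedH_max sumrN.
Qed.

Lemma embedHB x y i : embedH (fun j => x j - y j) i = embedH x i - embedH y i.
Proof. by rewrite (embedHD x (fun j => - y j)) embedHN. Qed.

Lemma inner_subr m (u v : 'I_m -> R) :
  inner (fun i => u i - v i) (fun i => u i - v i) =
  inner u u - 2 * inner u v + inner v v.
Proof.
rewrite /inner mulr_sumr -sumrB -big_split/=.
by apply: eq_bigr => i _; ring.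
Qed.

Lemma sum_mul_eq z i : \sum_k z k * (k == i)%:R = z i.
Proof.
rewrite (bigD1 i)//= eqxx mulr1 big1 ?addr0// => k /negbTE ->.
by rewrite mulr0.
Qed.

(** The roots [e_i - e_j] cut out the region: their inequalities imply those of all other lattice
    vectors. *)
Lemma voronoiAP z : voronoiA z <-> hyperH z /\ forall i j, z i - z j <= 1.
Proof.
split=> -[zH zV]; split=> //.
  move=> i j; have [->|ij] := eqVneq i j; first by rewrite subrr.
  (* The root [e_i - e_j] has squared length 2, so its inequality reads [2 (z_i - z_j) <= 2]. *)
  pose e k : R := (k == i)%:R - (k == j)%:R.
  have ez w : \sum_k w k * e k = w i - w j.
    by under eq_bigr do rewrite mulrBr; rewrite sumrB !sum_mul_eq.
  have eL : latticeA e.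
    split; first by move=> k; rewrite rpredB ?rpred_nat.
    have := ez (fun=> 1); rewrite subrr => e1; rewrite /hyperH/= -[RHS]e1.
    by apply: eq_bigr => k _; rewrite mul1r.
  have := zV e eL; rewrite inner_subr /inner !ez /e !eqxx.
  by rewrite (eq_sym j) (negbTE ij) mulr1n mulr0n => h; lra.
move=> l [lZ lH].
have [i0 _ i0min] := @arg_minP _ _ _ ord0 xpredT z isT.
rewrite inner_subr.
suff : 2 * inner z l <= inner l l by lra.
(* As [l] sums to 0, [z] may be shifted so that its entries lie in [-1/2, 1/2]. *)
have -> : 2 * inner z l = \sum_k (2 * z k - 2 * z i0 - 1) * l k.
  rewrite /inner mulr_sumr; apply/eqP; rewrite -subr_eq0 -sumrB.
  rewrite (eq_bigr (fun k => (2 * z i0 + 1) * l k)); last by move=> k _; ring.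
  by rewrite -mulr_sumr lH mulr0.
apply: ler_sum => k _; have /= := i0min k isT; have := zV k i0.
(* The coefficient of [l k] now lies in [-1, 1], and [c a <= a ^ 2] for such [c] and any integer
   [a]. *)
have /intrP[a ->] := lZ k.
have [a0|a0|->] := ltgtP a 0; last by rewrite !mulr0.
  have : (a%:~R : R) <= -1 by rewrite (_ : -1 = (-1)%:~R)// ler_int; lia.
  nra.
have : 1 <= (a%:~R : R) by rewrite (_ : 1 = 1%:~R)// ler_int; lia.
nra.
Qed.

Lemma pnorm_voronoiA z (r : R) : hyperH z -> (forall i j, z i - z j <= r) ->
  (exists i j, z i - z j = r) -> pnorm (@voronoiA R n) z = r.
Proof.
move=> zH zr [i [j zij]].
have r0 : 0 <= r by rewrite (le_trans _ (zr i i))// subrr.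
set S := (X in inf X = _); rewrite [LHS]/(inf S).
have lbS : lbound S r.
  move=> l [l0 [p [/voronoiAP[_ p1] zp]]].
  by rewrite -zij !zp -mulrBr ler_piMr.
have Sr : S r.
  (* If [r = 0], then [z] is constant with zero sum, hence zero, and the origin is a witness;
     otherwise [z / r] is one. *)
  split => //; have [r00|rn0] := eqVneq r 0.
    exists (fun=> 0); split.
      by apply/voronoiAP; split => [|? ?]; rewrite /hyperH/= ?big1 ?subrr.
    move=> k; rewrite mulr0.
    have zk k' : z k' = z k.
      by apply/le_anti/andP; split; rewrite -subr_le0 -r00 zr.
    have : \sum_k' z k' = 0 := zH.
    under eq_bigr do rewrite zk.
    by rewrite sumr_const card_ord => /eqP; rewrite mulrn_eq0 => /eqP.
  exists (fun k => z k / r); split; last by move=> k; rewrite mulrC divfK.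
  apply/voronoiAP; split.
    by rewrite /hyperH/= -mulr_suml (_ : \sum_k z k = 0) ?mul0r.
  by move=> k l; rewrite -mulrBl ler_pdivrMr ?mul1r// lt_def rn0.
apply/le_anti/andP; split; first by apply: ge_inf => //; exists r.
by apply: lb_le_inf => //; exists r.
Qed.

Lemma normA_eq1 x : normA x = 1 <->
  (forall i j, embedH x i - embedH x j <= 1) /\
  exists i j, embedH x i - embedH x j = 1.
Proof.
split=> [|[x1 ex]]; last exact: pnorm_voronoiA (embedH_hyperH x) x1 ex.
pose f (p : 'I_n.+1 * 'I_n.+1) := embedH x p.1 - embedH x p.2.
have [[i j] _ ijmax] := @arg_maxP _ _ _ (ord0, ord0) xpredT f isT.
rewrite /normA (@pnorm_voronoiA _ (f (i, j))).
- move=> f1; split => [k l|]; last by exists i, j.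
  by rewrite -f1; exact: (ijmax (k, l)).
- exact: embedH_hyperH.
- by move=> k l; exact: (ijmax (k, l)).
- by exists i, j.
Qed.

End Norm.

(** * Half vertices and the disjointness of translates *)

Section HalfVertices.
Variables (R : realType) (n : nat).

(* In the first [n] coordinates of [H], half the projection of the indicator
   of [T]; for proper nonempty [T] these are the halves of the Voronoi vertices. *)
Definition half_vertex (T : {set 'I_n.+1}) : 'I_n -> R :=
  fun j => ((lift ord_max j \in T)%:R - #|T|%:R / n.+1%:R) / 2.

(** The formula sums to zero over all indices, so it also gives the last coordinate. *)
Lemma embedH_half_vertex T i :
  embedH (half_vertex T) i = ((i \in T)%:R - #|T|%:R / n.+1%:R) / 2.
Proof.
rewrite (@eq_embedH _ _ _ (fun i => ((i \in T)%:R - #|T|%:R / n.+1%:R) / 2))//.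
rewrite /hyperH/= -mulr_suml sumrB sumr_const card_ord -[X in _ - X]mulr_natr.
rewrite divfK ?pnatr_eq0//.
rewrite (eq_bigr (fun i => if i \in T then 1 else 0)); last first.
  by move=> k _; case: (k \in T).
by rewrite -big_mkcond/= sumr_const subrr mul0r.
Qed.

Lemma half_vertex_le T j : `|half_vertex T j| <= 1.
Proof.
have : 0 <= (#|T|%:R / n.+1%:R : R) <= 1.
  rewrite divr_ge0//= ler_pdivrMr ?ltr0n// mul1r ler_nat.
  by rewrite (leq_trans (max_card _))// card_ord.
rewrite /half_vertex ler_norml; move: (_ / n.+1%:R) => q /andP[? ?].
by case: (_ \in _); rewrite ?mulr1n ?mulr0n; apply/andP; split; lra.
Qed.

Lemma half_vertexB (U V : {set 'I_n.+1}) j : V \subset U ->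
  half_vertex U j - half_vertex V j = half_vertex (U :\: V) j.
Proof.
move=> VU; rewrite /half_vertex.
have -> : (#|U|%:R : R) = #|V|%:R + #|U :\: V|%:R.
  by rewrite -natrD -[in LHS](cardsID V) (finset.setIidPr VU).
rewrite finset.in_setD.
have [/(fintype.subsetP VU) ->|_] := boolP (_ \in V) => /=; last by field.
by field.
Qed.

Variable A : set ('I_n -> R).
Hypothesis A1 : avoids_one (@normA R n) A.

(** The cardinality terms are constant and cancel in coordinate differences. The indicators
    contribute values in {-1/2, 0, 1/2}; for incomparable sets both extremes occur, giving norm
    1. *)
Lemma half_vertex_comparable p q (U V : {set 'I_n.+1}) : A p -> A q ->
  (forall j, p j - q j = half_vertex U j - half_vertex V j) ->
  (U \subset V) || (V \subset U).
Proof.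
move=> Ap Aq pq; apply: contraT; rewrite negb_or => /andP[].
move=> /fintype.subsetPn[i iU iV] /fintype.subsetPn[j jV jU]; case: (A1 Ap Aq).
have -> : (fun k => p k - q k) = (fun k => half_vertex U k - half_vertex V k).
  exact/funext.
apply/normA_eq1; split=> [k l|]; last exists i, j.
  rewrite !embedHB !embedH_half_vertex.
  move: (_ / _) (#|V|%:R / _) => u v.
  by case: (k \in U); case: (k \in V); case: (l \in U); case: (l \in V);
    rewrite ?mulr1n ?mulr0n; lra.
rewrite !embedHB !embedH_half_vertex; move: (_ / n.+1%:R) (#|V|%:R / _) => u v.
rewrite iU (negbTE iV) jV (negbTE jU) mulr1n mulr0n; lra.
Qed.

(* [free_direction b x] holds when [b] is an admissible choice of [b(x)]. *)
Definition free_direction (b : 'I_n.+1) : set ('I_n -> R) :=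
  A `\` \bigcup_(T in [set T : {set 'I_n.+1} | T != finset.set0 /\ b \notin T])
    translate (half_vertex T) A.

(** A [T] of least cardinality in the chain is contained in all the others, so each of its elements
    is a valid choice of [b(x)]. *)
Lemma free_direction_cover : A `<=` \bigcup_b free_direction b.
Proof.
move=> x Ax; apply: contrapT => nb.
pose F (T : {set 'I_n.+1}) := (T != finset.set0) && `[< A (fun j => x j + half_vertex T j) >].
have noT b : exists2 T, F T & b \notin T.
  apply: contrapT => noT; apply: nb; exists b => //; split => // -[T [T0 bT] AT].
  by apply: noT; exists T => //; rewrite /F T0; exact/asboolP.
have [T0 FT0 _] := noT ord0.
case: (@arg_minnP _ T0 F (fun T => #|T|) FT0) => T /andP[/finset.set0Pn[b bT] /asboolP AT] minT.
have [S FS bS] := noT b; have /andP[_ /asboolP AS] := FS.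
have /orP[TS|ST] : (T \subset S) || (S \subset T).
- by apply: half_vertex_comparable AT AS _ => j; ring.
- by rewrite (fintype.subsetP TS) in bS.
have : S \proper T by apply/properP; split => //; exists b.
by move=> /proper_card; rewrite ltnNge minT.
Qed.

(** The directions [b] and [c] may differ: one set contains the other, and the argument uses only
    the direction of the point that carries the larger set. *)
Lemma free_direction_packing x y b c (U V : {set 'I_n.+1}) :
  free_direction b x -> free_direction c y -> b \notin U -> c \notin V ->
  (forall j, x j + half_vertex U j = y j + half_vertex V j) -> U = V.
Proof.
have aux x' y' b' (U' V' : {set 'I_n.+1}) : free_direction b' x' -> A y' ->
    b' \notin U' ->
    (forall j, x' j + half_vertex U' j = y' j + half_vertex V' j) ->
    V' \subset U' -> U' = V'.
  move=> [_ nx] Ay bU xy VU; apply/eqP; rewrite finset.eqEsubset VU andbT.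
  rewrite -finset.setD_eq0; apply: contrapT => /negP UV0.
  apply: nx; exists (U' :\: V') => /=.
    by split => //; rewrite finset.in_setD negb_and bU orbT.
  rewrite /translate/= (_ : (fun j => _) = y')//; apply/funext => j.
  by rewrite -half_vertexB// addrA xy addrK.
move=> fx fy bU cV xy; have Ax := fx.1; have Ay := fy.1.
have /orP[VU|UV] : (V \subset U) || (U \subset V).
- apply: half_vertex_comparable Ax Ay _ => j.
  by rewrite -[x j](addrK (half_vertex U j)) xy; ring.
- exact: aux fx Ay bU xy VU.
- by apply/esym; exact: aux fy Ax cV (fun j => esym (xy j)) UV.
Qed.

End HalfVertices.

(** * Finite additivity and the packing bound in a cube *)

Lemma caratheodory_bigcup_fintype (R : realType) (T : pointedType)
    (mu : {outer_measure set T -> \bar R}) (I : finType)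
    (F : I -> set (caratheodory_type mu)) :
  (forall i, measurable (F i)) -> trivIset setT F ->
  mu (\bigcup_i F i) = (\sum_i mu (F i))%E.
Proof.
move=> mF tF.
rewrite [LHS](measure_fin_bigcup mu (finite_finset (X := setT)) tF)//.
have <- : [set` index_enum I] = [set: I].
  by apply/seteqP; split => x // _; rewrite /= mem_index_enum.
by rewrite -fsbig_seq ?index_enum_uniq.
Qed.

Section Packing.
Variables (R : realType) (m : nat).
Let n := m.+1.
Local Notation mu := (@leb_outer R n).
Local Notation lspace := (caratheodory_type (@leb_outer R n)).

Lemma measurable_translate (t : 'I_n -> R) (A : set lspace) :
  measurable A -> measurable (translate t A : set lspace).
Proof. by move=> /measurable_leb mA; apply/measurable_leb/leb_measurable_translate. Qed.

Lemma measurable_cube (r : R) : measurable (cube r : set lspace).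
Proof.
rewrite (_ : cube r =
    \bigcap_(i in [set: 'I_n]) (fun x : lspace => x i) @^-1` `[- r, r]).
  apply: fin_bigcap_measurable => [|i _]; first exact: finite_finset.
  rewrite -[X in measurable X]setTI.
  exact: (measurable_coordinate i measurableT (measurable_itv `[- r, r])).
by apply/seteqP; split => x xr i; have := xr i; rewrite /= in_itv/= //; apply.
Qed.

Lemma avoids_one_packing (A : set lspace) (r : R) : measurable A ->
  avoids_one (@normA R n) A ->
  ((2 ^ n)%:R%:E * mu (A `&` cube r) <= mu (@cube R n (r + 1)))%E.
Proof.
move=> mA A1.
(* [E b] keeps the points whose least free direction is [b], which makes the pieces disjoint. *)
pose E b : set lspace :=
  (free_direction A b `\` \bigcup_(c in [set c : 'I_n.+1 | (c < b)%N]) free_direction A c)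
  `&` cube r.
have mfree b : measurable (free_direction A b : set lspace).
  apply: measurableD => //; apply: fin_bigcup_measurable => [|T _].
    exact: finite_finset.
  exact: measurable_translate.
have mE b : measurable (E b).
  apply: measurableI; last exact: measurable_cube.
  apply: measurableD => //; apply: fin_bigcup_measurable => [|c _].
    exact: finite_finset.
  exact: mfree.
have tE : trivIset setT E.
  apply/trivIsetP => b c _ _ bc; apply/seteqP; split => // x [].
  move=> [[fb nb] _] [[fc nc] _]; have /orP[bc'|cb] : (b < c)%N || (c < b)%N.
    by rewrite -neq_ltn.
  - by apply: nc; exists b.
  - by apply: nb; exists c.
have AE : A `&` cube r = \bigcup_b E b.
  apply/seteqP; split => [x [Ax xr]|x [b _] [[[Ax _] _] xr]//].
  have [b0 _ fb0] := free_direction_cover A1 Ax.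
  have fb0' : `[< free_direction A b0 x >] by apply/asboolP.
  have [b /asboolP fb minb] := @arg_minnP _ b0
    (fun b => `[< free_direction A b x >]) (fun b : 'I_n.+1 => b : nat) fb0'.
  exists b => //; split => //; split => // -[c /= cb fc].
  by have := minb c (asboolT fc); rewrite leqNgt cb.
(* The piece is moved by [+ half_vertex]. Forbidden pairs give the empty set, so that the index type
   is a full product. *)
pose Q (p : 'I_n.+1 * {set 'I_n.+1}) : set lspace :=
  if p.1 \in p.2 then set0 else translate (fun j => - half_vertex R p.2 j) (E p.1).
have mQ p : measurable (Q p).
  by rewrite /Q; case: ifP => // _; exact: measurable_translate.
have tQ : trivIset setT Q.
  apply/trivIsetP => -[b U] [c V] _ _ bcUV; apply/seteqP; split => // x [].
  rewrite /Q/=; case: ifPn => // bU Ex; case: ifPn => // cV Ey.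
  have UV : U = V.
    apply: (free_direction_packing A1 Ex.1.1 Ey.1.1 bU cV) => j.
    by rewrite !subrK.
  subst V; have [bc|bc] := eqVneq b c; first by rewrite bc eqxx in bcUV.
  have /trivIsetP/(_ b c I I bc)/seteqP[bc0 _] := tE.
  by case: (bc0 _ (conj Ex Ey)).
have -> : ((2 ^ n)%:R%:E * mu (A `&` cube r) = mu (\bigcup_p Q p))%E.
  rewrite AE (caratheodory_bigcup_fintype mE tE).
  rewrite (caratheodory_bigcup_fintype mQ tQ).
  rewrite ge0_sume_distrr => [|b _]; last exact: leb_outer_ge0.
  rewrite -(pair_bigA _ (fun b U => mu (Q (b, U))))/=; apply: eq_bigr => b _.
  (* The admissible [U] are the subsets of the [n]-element complement of [b], so each piece has
     [2 ^ n] copies. *)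
  rewrite (eq_bigr (fun U => if U \in powerset [set~ b] then mu (E b) else 0%E)).
    rewrite -big_mkcond/= big_const card_powerset cardsC1 card_ord.
    by rewrite mule_natl /enatmul Monoid.iteropE.
  move=> U _; rewrite powersetE finset.subsetC finset.sub1set finset.in_setC /Q/=.
  by case: ifPn => _; [rewrite leb_outer0|rewrite leb_outer_translate].
apply: le_leb_outer => x [[b U] _]; rewrite /Q/=; case: ifP => // _ [_ xr] j.
have := xr j => /=.
have := half_vertex_le R U j.
by rewrite ler_norml => /andP[? ?] /andP[? ?]; apply/andP; split; lra.
Qed.

End Packing.

(* The [k] indices with the largest values of [f], smaller indices first in case
   of ties. *)
Lemma exists_top_subset (R : realType) (N : nat) (f : 'I_N -> R) (k : nat) :
  (k <= N)%N -> exists T : {set 'I_N}, #|T| = k /\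
    forall i j, i \notin T -> j \in T ->
      (f i < f j) || ((f i == f j) && (j < i)%N).
Proof.
elim: k => [|k IH] kN.
  by exists finset.set0; split=> [|i j _]; rewrite ?cards0// finset.in_set0.
have [T [Tk fT]] := IH (ltnW kN).
have /finset.set0Pn[a aT] : ~: T != finset.set0.
  by rewrite -card_gt0 cardsCs finset.setCK card_ord Tk subn_gt0.
(* The next index has the largest value outside [T] and, among those, the smallest position. *)
have [i1 i1T maxi1] := @arg_maxP _ _ _ a (mem (~: T)) f aT.
have i1P : (i1 \in ~: T) && (f i1 == f i1) by rewrite eqxx andbT.
have [i0 /andP[i0T /eqP fi0] mini0] := @arg_minnP _ i1
  (fun i => (i \in ~: T) && (f i == f i1)) (fun i : 'I_N => i : nat) i1P.
exists (i0 |: T); split.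
  by rewrite cardsU1 -finset.in_setC i0T Tk.
move=> i j; rewrite !finset.in_setU1 negb_or => /andP[ii0 iT] /orP[/eqP ->|jT].
  have iTC : i \in ~: T by rewrite finset.in_setC.
  have := maxi1 i iTC; rewrite fi0 /= le_eqVlt => /orP[/eqP fi|->//].
  rewrite fi eqxx orbC /= ltn_neqAle mini0 ?iTC ?fi ?eqxx//.
  by rewrite andbT eq_sym ii0.
exact: fT.
Qed.

Lemma embedHZ (R : realType) n (a : R) (x : 'I_n -> R) i :
  embedH (fun j => a * x j) i = a * embedH x i.
Proof.
case: (unliftP ord_max i) => [j ->|->]; first by rewrite !embedH_lift.
by rewrite !embedH_max -mulr_sumr mulrN.
Qed.

(** * Half-open cells, the lattice tiling and the extremal set *)

Section Tiling.
Variables (R : realType) (n : nat).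

(** For [r = 1] this is the Voronoi cell with one of each two opposite facets removed; [r = 2^-1]
    gives its half. *)
Definition half_open_cell (r : R) : set ('I_n -> R) := [set x |
  forall i j : 'I_n.+1, if (i < j)%N then embedH x i - embedH x j < r
                        else embedH x i - embedH x j <= r].

(* [embedH] identifies [Z^n] with the lattice [A_n]. *)
Definition lattice_vector (l : {ffun 'I_n -> int}) : 'I_n -> R :=
  fun j => (l j)%:~R.

Definition half_cell_packing : set ('I_n -> R) :=
  \bigcup_l [set x | half_open_cell 2^-1 (fun j => x j - lattice_vector l j)].

Lemma embedH_int l i : embedH (lattice_vector l) i \is a Num.int.
Proof.
case: (unliftP ord_max i) => [j ->|->].
  by rewrite embedH_lift /lattice_vector intr_int.
by rewrite embedH_max rpredN rpred_sum// => j _; rewrite /lattice_vector intr_int.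
Qed.

Lemma hyperH_le0 (z : 'I_n.+1 -> R) : hyperH z -> (forall i, z i <= 0) ->
  forall i, z i = 0.
Proof.
move=> zH z0 i; apply/eqP; rewrite -oppr_eq0; apply/eqP.
have := @psumr_eq0P _ _ xpredT (fun i => - z i); apply => //.
  by move=> k _; rewrite oppr_ge0.
by rewrite sumrN (_ : \sum_k z k = 0) ?oppr0.
Qed.

(** Applied to a nonzero lattice vector and to its opposite, this yields two coordinates that differ
    by at least 2. *)
Lemma hyperH_int_pos (z : 'I_n.+1 -> R) : hyperH z ->
  (forall i, z i \is a Num.int) -> (exists i, z i != 0) -> exists i, 1 <= z i.
Proof.
move=> zH zZ [i zi]; apply: contrapT => no.
case/negP: zi; apply/eqP; apply: hyperH_le0 zH _ i => k.
have /intrP[a za] := zZ k.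
have : ~ 1 <= z k by move=> zk; apply: no; exists k.
rewrite za => /negP; rewrite -ltNge -[1]/(1%:~R) ltr_int => a1.
by rewrite -[0]/(0%:~R) ler_int; lia.
Qed.

(** Write [x - y] as a lattice vector [w] plus a difference of two half-cell points, whose
    coordinate differences are below 1. The norm is then below 1 if [w = 0], and above [2 - 1]
    otherwise. *)
Lemma half_cell_packing_avoids_one : avoids_one (@normA R n) half_cell_packing.
Proof.
move=> x y [l _ xl] [k _ yk] /normA_eq1[xy1 [i0 [j0 xy_eq1]]].
pose d i j : R := embedH (fun j => x j - lattice_vector l j) i
  - embedH (fun j => x j - lattice_vector l j) j
  - (embedH (fun j => y j - lattice_vector k j) i
     - embedH (fun j => y j - lattice_vector k j) j).
(* The bounds for [x] at [(i, j)] and for [y] at [(j, i)] add up to 1, and exactly one of them is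
   strict. *)
have d1 i j : d i j < 1.
  have [->|] := eqVneq i j; first by rewrite /d !subrr ltr01.
  rewrite neq_ltn => ij; have := xl i j; have := yk j i; rewrite /d.
  by case/orP: ij => ij; rewrite ij ltnNge (ltnW ij)/=; lra.
pose w : 'I_n.+1 -> R :=
  embedH (fun j => lattice_vector l j - lattice_vector k j).
have xyE i j : embedH (fun j => x j - y j) i - embedH (fun j => x j - y j) j
    = w i - w j + d i j.
  by rewrite /w /d !embedHB; ring.
have wZ i : w i \is a Num.int by rewrite /w embedHB rpredB// embedH_int.
have wH : hyperH w := embedH_hyperH _.
have [w0|/existsNP[i /eqP wi]] := pselect (forall i, w i = 0).
  by have := d1 i0 j0; rewrite -xy_eq1 xyE !w0 subrr add0r ltxx.
have [p wp] : exists i, 1 <= w i by apply: hyperH_int_pos => //; exists i.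
have [q wq] : exists i, 1 <= - w i.
  apply: hyperH_int_pos => [|j|]; rewrite ?rpredN//.
    by rewrite /hyperH/= sumrN (_ : \sum_k w k = 0) ?oppr0.
  by exists i; rewrite oppr_eq0.
have := xy1 p q; rewrite xyE; have := d1 q p.
have -> : d q p = - d p q by rewrite /d; ring.
lra.
Qed.

Lemma half_open_cell_tiling x :
  exists l, half_open_cell 1 (fun j => x j - lattice_vector l j).
Proof.
pose f i : R := embedH x i - (Num.floor (embedH x i))%:~R.
have f01 i : 0 <= f i < 1.
  by rewrite subr_ge0 floor_le_tmp ltrBlDl -intrD1 floorD1_gt.
have [k fk] : exists k : nat, \sum_i f i = k%:R.
  have fZ : \sum_i f i \is a Num.int.
    rewrite sumrB (_ : \sum_i embedH x i = 0); last exact: embedH_hyperH.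
    by rewrite sub0r rpredN rpred_sum// => i _; rewrite intr_int.
  apply/natrP; rewrite natrEint fZ sumr_ge0// => i _.
  by case/andP: (f01 i).
have kn : (k <= n.+1)%N.
  rewrite -(ler_nat R) -fk -[X in _ <= X%:R](card_ord n.+1) -sumr_const.
  by apply: ler_sum => i _; case/andP: (f01 i) => _ /ltW.
(* Rounding down leaves fractional parts of sum [k]; rounding up the [k] largest
   of them instead lands in [A_n]. *)
have [T [Tk fT]] := exists_top_subset f kn.
pose z i : R := f i - (i \in T)%:R.
have zH : hyperH z.
  rewrite /hyperH/= sumrB fk -Tk.
  rewrite [X in _ - X](eq_bigr (fun i => if i \in T then 1 else 0)); last first.
    by move=> i _; case: (i \in T).
  by rewrite -big_mkcond/= sumr_const subrr.
exists [ffun j => Num.floor (x j) + (lift ord_max j \in T)%:R].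
rewrite /half_open_cell/= (@eq_embedH _ _ _ z)//; last first.
  move=> j; rewrite /lattice_vector ffunE /z /f embedH_lift intrD opprD addrA.
  by case: (_ \in T).
move=> i j; rewrite /z.
have /andP[fi0 fi1] := f01 i; have /andP[fj0 fj1] := f01 j.
(* Only [i] outside and [j] inside [T] is delicate: the difference is [f i - f j + 1], and a tie
   forces [j < i], where the cell allows equality. *)
have := fT i j.
case: (i \in T); case: (j \in T); rewrite ?mulr1n ?mulr0n.
- by move=> _; case: ifP => _; lra.
- by move=> _; case: ifP => _; lra.
- move=> /(_ isT isT) /orP[fij|/andP[/eqP -> ji]].
    by case: ifP => _; lra.
  by rewrite ltnNge (ltnW ji)/=; lra.
- by move=> _; case: ifP => _; lra.
Qed.

(** The tiling is applied to [2 x] and halved: quotients of [l] by 2 give the lattice vector,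
    remainders the shift [s]. *)
Lemma half_cell_packing_cover x : exists s : {ffun 'I_n -> bool},
  half_cell_packing (fun j => x j - (s j)%:R / 2).
Proof.
have [l lx] := half_open_cell_tiling (fun j => 2 * x j).
exists [ffun j => (l j %% 2)%Z == 1]; exists [ffun j => (l j %/ 2)%Z] => //.
have E i : embedH (fun j => x j - ([ffun j => (l j %% 2)%Z == 1] j)%:R / 2
    - lattice_vector [ffun j => (l j %/ 2)%Z] j) i =
    embedH (fun j => 2 * x j - lattice_vector l j) i / 2.
  rewrite mulrC -embedHZ; congr (embedH _ i); apply/funext => k.
  rewrite /lattice_vector !ffunE.
  have -> : ((l k)%:~R : R) = (l k %/ 2)%Z%:~R * 2 + ((l k %% 2)%Z == 1)%:R.
    rewrite {1}(divz_eq (l k) 2) intrD intrM; congr (_ + _).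
    have : (0 <= (l k %% 2)%Z < 2)%R by rewrite modz_ge0//= ltz_pmod.
    by case: (l k %% 2)%Z => [[|[|[]]]|].
  by field.
move=> i j; rewrite /= !E -mulrBl; have := lx i j.
by case: ifP => _; lra.
Qed.

End Tiling.

(** * Measurability of the extremal set and density estimates *)

Section PackingDensity.
Variables (R : realType) (m : nat).
Let n := m.+1.
Local Notation mu := (@leb_outer R n).
Local Notation lspace := (caratheodory_type (@leb_outer R n)).

Lemma measurable_embedH (i : 'I_n.+1) :
  measurable_fun [set: lspace] (fun x : lspace => embedH x i).
Proof.
case: (unliftP ord_max i) => [j ->|->].
  rewrite (_ : (fun x : lspace => _) = (fun x : lspace => x j)).
    exact: measurable_coordinate.
  by apply/funext => x; rewrite embedH_lift.
rewrite (_ : (fun x : lspace => _) = (fun x : lspace => - \sum_j x j)); last first.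
  by apply/funext => x; rewrite embedH_max.
apply: measurableT_comp => //.
by apply: measurable_sum => j; exact: measurable_coordinate.
Qed.

Lemma measurable_half_open_cell (r : R) :
  measurable (half_open_cell r : set lspace).
Proof.
rewrite (_ : half_open_cell r = \bigcap_(p in [set: 'I_n.+1 * 'I_n.+1])
  (fun x : lspace => embedH x p.1 - embedH x p.2) @^-1`
  [set` (if (p.1 < p.2)%N then `]-oo, r[ else `]-oo, r])]).
  apply: fin_bigcap_measurable => [|p _]; first exact: finite_finset.
  rewrite -[X in measurable X]setTI.
  have mf : measurable_fun [set: lspace]
      (fun x : lspace => embedH x p.1 - embedH x p.2).
    by apply: measurable_funB; exact: measurable_embedH.
  exact: (mf measurableT _ (measurable_itv _)).
apply/seteqP; split => [x xr [i j] _|x xr i j] /=.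
  by have := xr i j; case: ifP => _; rewrite /= in_itv.
by have := xr (i, j) I; rewrite /=; case: ifP => _; rewrite /= in_itv.
Qed.

Lemma measurable_half_cell_packing :
  measurable (@half_cell_packing R n : set lspace).
Proof.
apply: countable_bigcupT_measurable => [|l]; first exact: countableP.
apply: (@measurable_translate _ _ (fun j => - lattice_vector R l j)).
exact: measurable_half_open_cell.
Qed.

Lemma leb_outer_bigcup_le (I : finType) (F : I -> set ('I_n -> R)) :
  (mu (\bigcup_i F i) <= \sum_i mu (F i))%E.
Proof.
have <- : [set` index_enum I] = [set: I].
  by apply/seteqP; split => x // _; rewrite /= mem_index_enum.
rewrite bigcup_seq; elim: (index_enum I) => [|i s IH].
  by rewrite !big_nil leb_outer0.
by rewrite !big_cons (le_trans (outer_measureU2 _ _ _))// leeD2l.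
Qed.

(** The [2 ^ n] covering shifts move each coordinate by at most 1/2, so translates of the part in
    the larger cube cover the smaller one. *)
Lemma half_cell_packing_cube (r : R) :
  (mu (@cube R n (r - 1)) <=
   (2 ^ n)%:R%:E * mu (@half_cell_packing R n `&` cube r))%E.
Proof.
pose t (s : {ffun 'I_n -> bool}) : 'I_n -> R := fun j => - ((s j)%:R / 2).
set A := _ `&` _.
apply: (@le_trans _ _ (mu (\bigcup_s translate (t s) A))).
  apply: le_leb_outer => x xr; have [s xs] := half_cell_packing_cover x.
  exists s => //; split; first exact: xs.
  move=> j; have := xr j; rewrite /t /= => /andP[? ?].
  by case: (s j); rewrite ?mulr1n ?mulr0n; apply/andP; split; lra.
apply: le_trans (leb_outer_bigcup_le _) _.
under eq_bigr do rewrite leb_outer_translate.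
by rewrite big_const card_ffun card_bool card_ord mule_natl /enatmul Monoid.iteropE.
Qed.

Lemma leb_outer_cube (r : R) : 0 <= r -> mu (cube r) = ((2 * r) ^+ n)%:E.
Proof.
move=> r0; have <- : \prod_(i < n) (r - - r) = (2 * r) ^+ n.
  by rewrite prodr_const card_ord opprK -mulr2n mulr_natl.
have rr (i : 'I_n) : - r <= r by rewrite ge0_cp.
by apply/eqP; rewrite eq_le leb_outer_box//= leb_outer_box_ge.
Qed.

(** Chord bound: the left side is convex in [t], with values 1 and [2 ^+ k] at the endpoints. *)
Lemma expr1D_le (t : R) k : 0 <= t <= 1 -> (1 + t) ^+ k <= 1 + (2 ^+ k - 1) * t.
Proof.
move=> /andP[t0 t1]; elim: k => [|k IH]; first by rewrite !expr0 subrr mul0r addr0.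
have k1 : 1 <= 2 ^+ k :> R by rewrite exprn_ege1// ler1n.
rewrite exprSr (le_trans (ler_wpM2r _ IH)) ?addr_ge0// exprSr -subr_ge0.
have -> : 1 + (2 ^+ k * 2 - 1) * t - (1 + (2 ^+ k - 1) * t) * (1 + t) =
    (2 ^+ k - 1) * t * (1 - t) by ring.
by rewrite !mulr_ge0// subr_ge0.
Qed.

(** Bernoulli's inequality. *)
Lemma expr1B_ge (t : R) k : 0 <= t <= 1 -> 1 - k%:R * t <= (1 - t) ^+ k.
Proof.
move=> /andP[t0 t1]; elim: k => [|k IH]; first by rewrite expr0 mul0r subr0.
rewrite exprSr (le_trans _ (ler_wpM2r _ IH)) ?subr_ge0// -natr1.
have : 0 <= k%:R :> R by []; nra.
Qed.

Lemma density_le (A : set ('I_n -> R)) : leb_measurable A ->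
  avoids_one (@normA R n) A -> (density A <= ((2 : R) ^+ n)^-1%:E)%E.
Proof.
move=> mA A1; apply/lee_addgt0Pr => e e0.
have e1 : 0 < e^-1 by rewrite invr_gt0.
have M0 : 0 < e^-1 + 1 by rewrite addr_gt0.
(* Beyond the threshold [e^-1 + 1] one has [r^-1 <= e], which bounds the error, as the factor
   [2 ^- n] brings the chord slope below 1. *)
apply: ge_ereal_inf; exists (ereal_sup
  [set (mu (A `&` cube r) * ((2 * r) ^+ n)^-1%:E)%E | r in [set r | e^-1 + 1 < r]]).
  by exists (e^-1 + 1).
apply: ge_ereal_sup => _ [r /= Mr <-].
have r0 : 0 < r by lra.
have := @avoids_one_packing R m A r mA A1.
rewrite leb_outer_cube; last by lra.
rewrite natrX -lee_pdivlMl ?exprn_gt0// => muA.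
apply: le_trans (lee_wpmul2r _ muA) _.
  by rewrite lee_fin invr_ge0 exprn_ge0// mulr_ge0// ltW.
rewrite -!EFinM lee_fin.
have -> : (2 ^+ n)^-1 * (2 * (r + 1)) ^+ n * ((2 * r) ^+ n)^-1 =
    (2 ^+ n)^-1 * (1 + r^-1) ^+ n.
  rewrite -mulrA; congr (_ * _); rewrite -exprVn -exprMn; congr (_ ^+ _).
  by field; rewrite gt_eqF.
have t01 : 0 <= r^-1 <= 1.
  by rewrite invr_ge0 ltW//= invf_le1//; lra.
apply: le_trans (ler_wpM2l _ (expr1D_le n t01)) _.
  by rewrite invr_ge0 exprn_ge0.
rewrite mulrDr mulr1 lerD2l mulrBl mul1r mulrBr mulKf ?expf_neq0//.
have re : r^-1 <= e by rewrite invf_ple ?posrE//; lra.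
rewrite (le_trans _ re)// gerBl mulr_ge0 ?invr_ge0 ?exprn_ge0//.
exact: ltW.
Qed.

Lemma density_half_cell_packing :
  (((2 : R) ^+ n)^-1%:E <= density (@half_cell_packing R n))%E.
Proof.
apply: le_ereal_inf_tmp => _ [M /= M0 <-]; apply/lee_addgt0Pr => e e0.
(* A single radius above [M] bounds the supremum from below; the term [n%:R / e] makes the Bernoulli
   error [n / r] at most [e]. *)
pose r := M + 1 + n%:R / e.
have ne0 : 0 <= n%:R / e by rewrite divr_ge0// ltW.
have r1 : 1 <= r by rewrite /r; lra.
have r0 : 0 < r by lra.
apply: (@le_trans _ _
  (mu (@half_cell_packing R n `&` cube r) * ((2 * r) ^+ n)^-1%:E + e%:E)%E).
  rewrite -leeBlDr//.
  have := @half_cell_packing_cube r.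
  rewrite leb_outer_cube ?subr_ge0// natrX -lee_pdivrMl ?exprn_gt0// => muA.
  apply: le_trans (lee_wpmul2r _ muA); last first.
    by rewrite lee_fin invr_ge0 exprn_ge0// mulr_ge0// ltW.
  rewrite -!EFinM -EFinB lee_fin.
  have -> : (2 ^+ n)^-1 * (2 * (r - 1)) ^+ n * ((2 * r) ^+ n)^-1 =
      (2 ^+ n)^-1 * (1 - r^-1) ^+ n.
    rewrite -mulrA; congr (_ * _); rewrite -exprVn -exprMn; congr (_ ^+ _).
    by field; rewrite gt_eqF.
  have t01 : 0 <= r^-1 <= 1.
    by rewrite invr_ge0 ltW//= invf_le1.
  apply: le_trans (ler_wpM2l _ (expr1B_ge n t01)).
    rewrite mulrBr mulr1 lerD2l lerN2.
    have nr : n%:R * r^-1 <= e.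
      rewrite ler_pdivrMr// mulrC -ler_pdivrMr// /r; lra.
    apply: le_trans nr; rewrite ler_piMl//.
      by rewrite mulr_ge0// invr_ge0 ltW.
    by rewrite invf_le1 ?exprn_gt0// exprn_ege1// ler1n.
  by rewrite invr_ge0 exprn_ge0.
rewrite leeD2r//; apply: ereal_sup_ubound; exists r => //=.
by rewrite /r; lra.
Qed.

End PackingDensity.

Theorem theorem4 (R : realType) (n : nat) (hn : (2 <= n)%N) :
  m1 (@normA R n) = (((2 : R) ^+ n)^-1)%:E.
Proof.
case: n hn => [//|n] _; apply/eqP; rewrite eq_le; apply/andP; split.
  by apply: ge_ereal_sup => _ [A [mA A1] <-]; exact: density_le.
apply: le_trans (density_half_cell_packing R n) _.
apply: ereal_sup_ubound; exists (@half_cell_packing R n.+1) => //.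
split; last exact: half_cell_packing_avoids_one.
exact/measurable_leb/measurable_half_cell_packing.
Qed.
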